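(* Let $a,b\in\mathbb{Z}_{>0}$ be relatively prime, let $t\in\mathbb{R}$, let $f(x):=\frac{ax+t}{b}$, and let $(p,q)\in\mathbb{R}^2$ be a point on the graph of $f$ (that is, $q=f(p)$). Then, as an identity of Laurent polynomials in the variables $u$ and $v$, \[ v(1-u)\,\mathrm{R}(v,u,p,f)+u(1-v)\,\mathrm{R}(u,v,q,f^{-1}) = u^{\lceil p\rceil}v^{\lceil q\rceil}\left(1-u^b v^a\right)-u^c v^d(1-u)(1-v), \] where $(c,d)$ is the unique lattice point (point of $\mathbb{Z}^2$) on the half-open line segment $[(p,q),(p+b,q+a))$; if there are no integer points on the graph of $f$ (so that $(c,d)$ does not exist), the last term $-u^cv^d(1-u)(1-v)$ on the right-hand side is to be omitted.
   Context: For a linear function $g(x)=\frac{\alpha x+\tau}{\beta}$ with $\alpha,\beta\in\mathbb{Z}_{>0}$ and $\tau\in\mathbb{R}$, a real number $s$, and variables $u,v$, the Rademacher--Carlitz polynomial is \[ \mathrm{R}(u,v,s,g):=\mathrm{R}(u,v,s,\tau,\alpha,\beta):=\sum_{k=\lceil s\rceil}^{\lceil s\rceil+\beta-1}u^{\lfloor g(k)\rfloor}v^k , \] where the number of summands is the denominator $\beta$ in the given expression of $g$. Exponents may be negative, so these are Laurent polynomials in general. For $f(x)=\frac{ax+t}{b}$ the inverse function is $f^{-1}(y)=\frac{by-t}{a}$, with denominator $a$. Thus $\mathrm{R}(v,u,p,f)=\sum_{k=\lceil p\rceil}^{\lceil p\rceil+b-1}v^{\lfloor (ak+t)/b\rfloor}u^k$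 and $\mathrm{R}(u,v,q,f^{-1})=\sum_{k=\lceil q\rceil}^{\lceil q\rceil+a-1}u^{\lfloor (bk-t)/a\rfloor}v^k$. The half-open segment $[(p,q),(p+b,q+a))$ is $\{(p,q)+\lambda(b,a): 0\le\lambda<1\}$. *)

(* Defs.v *)
From HB Require Import structures.
From mathcomp Require Import all_boot all_order all_algebra.
From mathcomp Require Import finmap.
From mathcomp.multinomials Require Import monalg.
From mathcomp Require Import boolp reals.

Set Implicit Arguments.
Unset Strict Implicit.
Unset Printing Implicit Defensive.

Import Order.TTheory GRing.Theory Num.Theory.

Local Open Scope ring_scope.

(* The Laurent polynomial ring K[u, u^-1, v, v^-1], as the group ring of
   Z^2: finitely supported functions int * int -> K with the convolution
   product.  The ring structure of monalg is not available here: it requires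
   a monoid of exponents in which only the identity is invertible. *)
Definition laurent2 (K : comNzRingType) : Type := {malg K[(int * int)%type]}.

HB.instance Definition _ (K : comNzRingType) :=
  GRing.Zmodule.copy (laurent2 K) {malg K[(int * int)%type]}.

Definition lmonom (K : comNzRingType) (i j : int) : laurent2 K := << (i, j) >>.
Arguments lmonom {K} i j.

Section LaurentRing.
Variable K : comNzRingType.
Local Notation L := {malg K[(int * int)%type]}.
Implicit Types (g : L) (k : int * int) (c : K) (d : {fset (int * int)%type}).

Definition laurent_mul g1 g2 : L :=
  \sum_(k1 <- msupp g1) \sum_(k2 <- msupp g2)
    << g1@_k1 * g2@_k2 *g (k1.1 + k2.1, k1.2 + k2.2) >>.

Lemma laurent_mulw d1 d2 g1 g2 :
  (msupp g1 `<=` d1)%fset -> (msupp g2 `<=` d2)%fset ->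
  laurent_mul g1 g2 = \sum_(k1 <- d1) \sum_(k2 <- d2)
    << g1@_k1 * g2@_k2 *g (k1.1 + k2.1, k1.2 + k2.2) >>.
Proof.
move=> le_d1 le_d2; rewrite /laurent_mul (big_fset_incl _ le_d1) /=.
  apply/eq_bigr=> k1 _; apply/big_fset_incl => // k _ /mcoeff_outdom ->.
  by rewrite mulr0 monalgU0.
move=> k _ /mcoeff_outdom g1k.
by rewrite big1 => // k' _; rewrite g1k mul0r monalgU0.
Qed.

Lemma laurent_mulC : commutative laurent_mul.
Proof.
move=> g1 g2; rewrite /laurent_mul exchange_big; apply/eq_bigr => k2 _.
by apply/eq_bigr => k1 _; rewrite mulrC [k1.1 + _]addrC [k1.2 + _]addrC.
Qed.

Lemma laurent_mulDl : left_distributive laurent_mul +%R.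
Proof.
move=> g1 g2 g; have sub := fsubset_refl (msupp g).
rewrite (laurent_mulw (msuppD_le g1 g2) sub).
rewrite (laurent_mulw (fsubsetUl _ (msupp g2)) sub).
rewrite (laurent_mulw (fsubsetUr (msupp g1) _) sub).
rewrite -big_split /=; apply/eq_bigr=> k1 _.
rewrite -big_split /=; apply/eq_bigr=> k2 _.
by rewrite mcoeffD mulrDl monalgUD.
Qed.

Lemma laurent_mul0g : left_zero 0 laurent_mul.
Proof. by move=> g; rewrite /laurent_mul msupp0 big_seq_fset0. Qed.

Lemma laurent_mulUU c1 c2 k1 k2 :
  laurent_mul << c1 *g k1 >> << c2 *g k2 >>
    = << c1 * c2 *g (k1.1 + k2.1, k1.2 + k2.2) >>.
Proof.
by rewrite (laurent_mulw msuppU_le msuppU_le) !big_seq_fset1 !mcoeffUU.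
Qed.

Lemma laurent_mul_suml I (r : seq I) (F : I -> L) g :
  laurent_mul (\sum_(i <- r) F i) g = \sum_(i <- r) laurent_mul (F i) g.
Proof.
exact: (big_morph (laurent_mul^~ g) (fun _ _ => laurent_mulDl _ _ _)
                  (laurent_mul0g _)).
Qed.

Lemma laurent_mul_sumr I (r : seq I) (F : I -> L) g :
  laurent_mul g (\sum_(i <- r) F i) = \sum_(i <- r) laurent_mul g (F i).
Proof.
by rewrite laurent_mulC laurent_mul_suml; under eq_bigr do rewrite laurent_mulC.
Qed.

Lemma laurent_mulA : associative laurent_mul.
Proof.
move=> g1 g2 g3; rewrite (monalgE g1) !laurent_mul_suml; apply/eq_bigr => k1 _.
rewrite (monalgE g2) laurent_mul_suml !laurent_mul_sumr laurent_mul_suml.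
apply/eq_bigr => k2 _; rewrite (monalgE g3) !laurent_mul_sumr.
by apply/eq_bigr => k3 _; rewrite !laurent_mulUU /= mulrA !addrA.
Qed.

Lemma laurent_mul1g : left_id (lmonom 0 0) laurent_mul.
Proof.
move=> g; rewrite [in LHS](monalgE g) laurent_mul_sumr [RHS]monalgE.
by apply/eq_bigr => -[i j] _; rewrite laurent_mulUU mul1r /= !add0r.
Qed.

Lemma laurent_oner_neq0 : lmonom 0 0 != 0 :> L.
Proof. by rewrite monalgU_eq0 oner_eq0. Qed.

End LaurentRing.

HB.instance Definition _ (K : comNzRingType) :=
  GRing.Zmodule_isComNzRing.Build (laurent2 K)
    (@laurent_mulA K) (@laurent_mulC K) (@laurent_mul1g K)
    (@laurent_mulDl K) (@laurent_oner_neq0 K).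

Section LaurentUnitRing.
Variable K : comNzRingType.
Implicit Types x y : laurent2 K.

Definition laurent_unit : pred (laurent2 K) :=
  fun x => `[< exists y, y * x == 1 >].

Definition laurent_inv x : laurent2 K :=
  if pselect (exists y, y * x == 1) is left xV then xchoose xV else x.

Lemma laurent_mulVr : {in laurent_unit, left_inverse 1 laurent_inv *%R}.
Proof.
move=> x /asboolP x_unit; rewrite /laurent_inv; case: pselect => // xV.
exact/eqP/(xchooseP xV).
Qed.

Lemma laurent_unitPl x y : y * x = 1 -> laurent_unit x.
Proof. by move=> yx1; apply/asboolP; exists y; apply/eqP. Qed.

Lemma laurent_invr_out : {in [predC laurent_unit], laurent_inv =1 id}.
Proof.
by move=> x /asboolPn x_nunit; rewrite /laurent_inv; case: pselect.
Qed.

End LaurentUnitRing.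

HB.instance Definition _ (K : comNzRingType) :=
  GRing.ComNzRing_hasMulInverse.Build (laurent2 K)
    (@laurent_mulVr K) (@laurent_unitPl K) (@laurent_invr_out K).

Definition lvaru (K : comNzRingType) : laurent2 K := lmonom 1 0.
Definition lvarv (K : comNzRingType) : laurent2 K := lmonom 0 1.

Section LaurentMonomials.
Variable K : comNzRingType.

Lemma lmonomM (i j i' j' : int) :
  lmonom i j * lmonom i' j' = lmonom (i + i') (j + j') :> laurent2 K.
Proof. by rewrite [LHS](@laurent_mulUU K) mulr1. Qed.

Lemma lmonom_unit (i j : int) : (lmonom i j : laurent2 K) \is a GRing.unit.
Proof.
by apply/unitrP; exists (lmonom (- i) (- j)); rewrite !lmonomM !addNr !addrN.
Qed.

Lemma lmonomX (i j n : int) :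
  lmonom i j ^ n = lmonom (i * n) (j * n) :> laurent2 K.
Proof.
have nat_case m : lmonom i j ^+ m = lmonom (i * m%:Z) (j * m%:Z) :> laurent2 K.
  elim: m => [|m IHm]; first by rewrite !mulr0.
  by rewrite exprS IHm lmonomM intS !mulrDr !mulr1.
case: n => m; first exact: nat_case.
rewrite NegzE -exprnN nat_case; apply: (mulrI (lmonom_unit (i * m.+1) (j * m.+1))).
by rewrite divrr ?lmonom_unit // lmonomM !mulrN !addrN.
Qed.

Lemma lmonomE (i j : int) : lvaru K ^ i * lvarv K ^ j = lmonom i j.
Proof. by rewrite !lmonomX lmonomM !mul1r !mul0r addr0 add0r. Qed.

End LaurentMonomials.

(* The expression (lin_num * x + lin_shift) / lin_den, as opposed to the
   function of x it defines: the number of terms of a Rademacher-Carlitz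
   polynomial is lin_den, which depends on the expression. *)
Record linfrac (R : Type) :=
  LinFrac { lin_num : nat; lin_shift : R; lin_den : nat }.

Definition linfrac_eval (R : realType) (g : linfrac R) (x : R) : R :=
  ((lin_num g)%:R * x + lin_shift g) / (lin_den g)%:R.
Coercion linfrac_eval : linfrac >-> Funclass.

Definition linfrac_inv (R : realType) (g : linfrac R) : linfrac R :=
  LinFrac (lin_den g) (- lin_shift g) (lin_num g).

Lemma linfrac_invK (R : realType) (g : linfrac R) :
  (0 < lin_num g)%N -> (0 < lin_den g)%N -> cancel g (linfrac_inv g).
Proof.
move=> num_gt0 den_gt0 x; rewrite /linfrac_eval /= mulrC.
have num_neq0 : (lin_num g)%:R != 0 :> R by rewrite pnatr_eq0 -lt0n.
have den_neq0 : (lin_den g)%:R != 0 :> R by rewrite pnatr_eq0 -lt0n.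
by rewrite [_ * (_ / _)]mulrC divfK // addrK mulKf.
Qed.

(* Exponents are integers, so u and v should be units of A. *)
Definition rademacher_carlitz (A : unitRingType) (R : realType)
    (u v : A) (s : R) (g : linfrac R) : A :=
  \sum_(0 <= j < lin_den g)
    let k : int := Num.ceil s + j%:Z in u ^ Num.floor (g k%:~R) * v ^ k.

(* [z, z + w) *)
Definition half_open_segment (R : realType) (z w y : R * R) : Prop :=
  exists2 l : R, 0 <= l < 1 & y = (z.1 + l * w.1, z.2 + l * w.2).

Definition intpoint (R : realType) (m : int * int) : R * R :=
  (m.1%:~R, m.2%:~R).
Arguments intpoint R m : clear implicits.

(* Main.v *)
Require Import Defs.
From mathcomp Require Import all_boot all_order all_algebra.
From mathcomp Require Import reals zify ring lra.

Import Order.TTheory GRing.Theory Num.Theory.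
Local Open Scope ring_scope.

(** Weigh the lattice point (i, j) by u^i v^j, and follow the staircase of
    lattice points (ceil x, ceil (f x)) as x runs from p to p + b, that is from
    (P, Q) = (ceil p, ceil q) to (P + b, Q + a); where x and f x pass through
    integers together, take the horizontal step first.  The difference of the end
    weights is u^P v^Q (1 - u^b v^a), and it is also the sum of the contributions
    of the steps.  A horizontal step leaves column k at height ceil (f k) and
    contributes (1 - u) u^k v^(ceil (f k)).  A vertical step leaves row j in
    column floor (f^-1 j) + 1 and contributes (1 - v) u^(floor (f^-1 j) + 1) v^j.
    This is [galois_staircase]; it uses only that i |-> ceil (f i) and
    j |-> floor (f^-1 j) are adjoint monotone maps from Z to Z, because f i <= j
    means i <= f^-1 j.

    The vertical steps add up to u (1 - v) R(u, v, q, f^-1).  The horizontal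
    steps would add up to v (1 - u) R(v, u, p, f) if ceil (f k) were always
    floor (f k) + 1.  This fails exactly when f k is an integer, and then the
    error is (1 - u) (1 - v) u^k v^(f k).  So
    [rademacher_carlitz_reciprocity] holds for all a, b > 0 with one correction
    term for each integer point of the graph over P <= k < P + b.

    These integer points are those of the half-open segment
    ([half_open_segment_intP]).  Any integer point of the graph can be moved onto
    the segment by a multiple of (b, a), and since a and b are coprime the
    abscissas of two integer points differ by a multiple of b.  Hence there is
    exactly one correction term, or none if the graph has no integer point. *)

(** * Staircases *)

(** The left side sums the steps of a path from (P, Q) to (P + n, Q + m).  The
    bounds on Q and Q + m say that both ends lie on the staircase: in column i
    it occupies the heights from c (i - 1) to c i.  For an end to lie on the
    staircase is enough to make its last step known, whence induction on the
    number n + m of steps. *)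
Lemma galois_staircase (A : comUnitRingType) (u v : A) (c g : int -> int)
    (P Q : int) :
  u \is a GRing.unit -> v \is a GRing.unit ->
  (forall i j, (c i <= j) = (i <= g j)) ->
  c (P - 1) <= Q <= c P ->
  forall n m : nat, c (P + n%:Z - 1) <= Q + m%:Z <= c (P + n%:Z) ->
  (1 - u) * (\sum_(0 <= k < n) u ^ (P + k%:Z) * v ^ c (P + k%:Z))
  + u * (1 - v) * (\sum_(0 <= j < m) u ^ g (Q + j%:Z) * v ^ (Q + j%:Z))
  = u ^ P * v ^ Q - u ^ (P + n%:Z) * v ^ (Q + m%:Z).
Proof.
move=> uu vu cg /andP[cP Pc] n m; have [s] := ubnP (n + m).
have c_mono i j : i <= j -> c i <= c j.
  by move=> le_ij; rewrite cg (le_trans le_ij) // -cg.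
elim: s n m => // s IHs n m; rewrite ltnS => le_nm_s /andP[lo hi].
(* The last step is vertical iff its lower end is still on the staircase. *)
have [vert | not_vert] := boolP ((0 < m)%N && (c (P + n%:Z - 1) <= Q + m.-1%:Z)).
  case/andP: vert => m_gt0 lo'; case: m m_gt0 => // m _ /= in le_nm_s lo hi lo' *.
  have g_eq : g (Q + m%:Z) = P + n%:Z - 1.
    move: lo'; rewrite cg => ge_g.
    have : ~~ (P + n%:Z <= g (Q + m%:Z)) by rewrite -cg; lia.
    by lia.
  rewrite big_nat_recr //= g_eq mulrDr addrA IHs; [ | lia | lia].
  have -> : P + n%:Z = 1 + (P + n%:Z - 1) by lia.
  have -> : Q + m.+1%:Z = 1 + (Q + m%:Z) by lia.
  have -> : 1 + (P + n%:Z - 1) - 1 = P + n%:Z - 1 by lia.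
  by rewrite !exprzDr // expr1z; ring.
case: n => [|n] in le_nm_s lo hi not_vert *.
  (* In the starting column every step is vertical, so the path is empty. *)
  case: m => [|m] in le_nm_s lo hi not_vert *; last by rewrite addr0 in not_vert lo; lia.
  by rewrite !big_geq // !addr0 !mulr0 subrr addr0.
(* The last step is horizontal: (P + n + 1, Q + m) is the lowest point of its
   column. *)
have c_eq : c (P + n%:Z) = Q + m%:Z.
  have -> : P + n%:Z = P + n.+1%:Z - 1 by lia.
  have := c_mono P (P + n.+1%:Z - 1); case: m => [|m] in le_nm_s lo hi not_vert *; lia.
rewrite big_nat_recr //= c_eq mulrDr addrAC IHs; [ | lia | ]; last first.
  by rewrite -c_eq lexx andbT; apply: c_mono; lia.
have -> : P + n.+1%:Z = 1 + (P + n%:Z) by lia.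
by rewrite (exprzDr uu 1) expr1z; ring.
Qed.

(** * Affine functions and their integer points *)

Lemma int_window_ordP (P c : int) (n : nat) :
  reflect (exists j : 'I_n, c = P + j%:Z) (P <= c < P + n%:Z).
Proof.
apply: (iffP andP) => [[lo hi]|[j ->]]; last by have := ltn_ord j; lia.
have k_lt : (`|c - P| < n)%N by lia.
by exists (Ordinal k_lt) => /=; lia.
Qed.

(** The step that replaces ceil x by floor x + 1 in the exponents; the two
    integers differ exactly when x is an integer. *)
Lemma expr_ceil_floor (A : unitRingType) (R : realType) (v : A) (x : R) :
  v \is a GRing.unit ->
  v * v ^ Num.floor x
  = v ^ Num.ceil x - ((1 - v) * v ^ Num.floor x) *+ (x \is a Num.int).
Proof.
move=> vu; rewrite ceil_floor; case: (x \is a Num.int) => /=.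
  by rewrite addr0 mulrBl mul1r subKr.
by rewrite subr0 addrC exprzDr // expr1z.
Qed.

Section LinFrac.
Variables (R : realType) (f : linfrac R).
Hypotheses (num_gt0 : (0 < lin_num f)%N) (den_gt0 : (0 < lin_den f)%N).

Let num_gt0R : 0 < (lin_num f)%:R :> R. Proof. by rewrite ltr0n. Qed.
Let den_gt0R : 0 < (lin_den f)%:R :> R. Proof. by rewrite ltr0n. Qed.

Lemma linfrac_le_inv (x y : R) : (f x <= y) = (x <= linfrac_inv f y).
Proof.
rewrite /linfrac_eval /= ler_pdivrMr // ler_pdivlMr //.
by apply/idP/idP; lra.
Qed.

Lemma linfrac_mono (x y : R) : x <= y -> f x <= f y.
Proof.
move=> le_xy; rewrite /linfrac_eval ler_pM2r ?invr_gt0 //.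
by rewrite lerD2r ler_pM2l.
Qed.

(** The factor l is real so as to give both the points of the segment and, for
    integral l, the translations that permute the integer points of the graph. *)
Lemma linfracDM (l x : R) :
  f (x + l * (lin_den f)%:R) = f x + l * (lin_num f)%:R.
Proof. by rewrite /linfrac_eval; field; rewrite gt_eqF. Qed.

Lemma linfrac_int_ceil_floor (i j : int) :
  (Num.ceil (f i%:~R) <= j) = (i <= Num.floor (linfrac_inv f j%:~R)).
Proof. by rewrite ceil_le_int floor_ge_int linfrac_le_inv. Qed.

(** The staircase from (ceil p, ceil (f p)) to its translate by (b, a), in which
    each height ceil (f k) has been traded for floor (f k) + 1. *)
Lemma rademacher_carlitz_reciprocity (A : comUnitRingType) (u v : A) (p : R) :
  u \is a GRing.unit -> v \is a GRing.unit ->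
  v * (1 - u) * rademacher_carlitz v u p f
  + u * (1 - v) * rademacher_carlitz u v (f p) (linfrac_inv f)
  = u ^ Num.ceil p * v ^ Num.ceil (f p)
      * (1 - u ^+ lin_den f * v ^+ lin_num f)
    - (1 - u) * (1 - v)
      * \sum_(0 <= j < lin_den f) let k : int := Num.ceil p + j%:Z in
          (u ^ k * v ^ Num.floor (f k%:~R)) *+ (f k%:~R \is a Num.int).
Proof.
move=> uu vu; set P := Num.ceil p; set Q := Num.ceil (f p).
have [Plt pP] : (P - 1)%:~R < p /\ p <= P%:~R by apply/andP/ceil_itv.
have cP : Num.ceil (f (P - 1)%:~R) <= Q by apply/le_ceil/linfrac_mono/ltW.
have Pc : Q <= Num.ceil (f P%:~R) by apply/le_ceil/linfrac_mono.
have c_shift (i : int) : Num.ceil (f (i + lin_den f)%:~R)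
    = Num.ceil (f i%:~R) + lin_num f :> int.
  rewrite intrD -pmulrn -[(lin_den f)%:R]mul1r linfracDM mul1r.
  by rewrite ceilDrz ?intrKceil // ?natr_int // pmulrn intrKceil.
(* The translation by (b, a) carries the bounds on the starting point to the
   bounds on the end point. *)
have := @galois_staircase A u v (fun i => Num.ceil (f i%:~R))
  (fun j => Num.floor (linfrac_inv f j%:~R)) P Q uu vu linfrac_int_ceil_floor
  _ (lin_den f) (lin_num f) _.
rewrite [P + _ - 1]addrAC !c_shift cP Pc !lerD2r cP Pc => /(_ isT isT) stair.
have -> : v * (1 - u) * rademacher_carlitz v u p f
    = (1 - u) * (\sum_(0 <= k < lin_den f)
                   u ^ (P + k%:Z) * v ^ Num.ceil (f (P + k%:Z)%:~R))
    - (1 - u) * (1 - v)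
      * \sum_(0 <= j < lin_den f) let k : int := Num.ceil p + j%:Z in
          (u ^ k * v ^ Num.floor (f k%:~R)) *+ (f k%:~R \is a Num.int).
  rewrite -[(1 - u) * _ * \sum_(_ <= _ < _) _]mulrA -mulrBr [v * _]mulrC -mulrA.
  congr (_ * _); rewrite !mulr_sumr -sumrB; apply: eq_bigr => j _ /=.
  rewrite mulrA expr_ceil_floor // -/P mulrBl [_ * u ^ _]mulrC.
  by congr (_ - _); rewrite mulrnAl mulrnAr -mulrA [_ * u ^ _]mulrC.
rewrite addrAC {}stair; congr (_ - _).
by rewrite !exprzDr // -!exprnP; ring.
Qed.

Lemma half_open_segment_intP (p : R) (c d : int) :
  half_open_segment (p, f p) ((lin_den f)%:R, (lin_num f)%:R) (intpoint R (c, d))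
  <-> Num.ceil p <= c < Num.ceil p + (lin_den f)%:Z /\ f c%:~R = d%:~R.
Proof.
have -> : (c < Num.ceil p + (lin_den f)%:Z) = (c%:~R < p + (lin_den f)%:R).
  by rewrite -ltrBlDr ltNge ceil_le_int intrB -pmulrn lerBrDr -ltNge.
rewrite ceil_le_int /intpoint; split=> [[l /andP[l_ge0 l_lt1] [-> ->]]|].
  split; last by rewrite linfracDM.
  by rewrite lerDl mulr_ge0 ?(ltW den_gt0R) //= ltrD2l gtr_pMl.
case=> /andP[pc cp] fc; exists ((c%:~R - p) / (lin_den f)%:R).
  by rewrite divr_ge0 ?subr_ge0 //= ltr_pdivrMr // mul1r ltrBlDl.
have cE : c%:~R = p + (c%:~R - p) / (lin_den f)%:R * (lin_den f)%:R.
  by rewrite divfK ?gt_eqF // addrC subrK.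
by rewrite -linfracDM /= -cE fc.
Qed.

(** Euclidean division by b tells by which multiple of (b, a) to translate the
    given point of the graph. *)
Lemma segment_int_exists (p : R) (x y : int) :
  f x%:~R = y%:~R ->
  exists m : int * int, half_open_segment (p, f p)
    ((lin_den f)%:R, (lin_num f)%:R) (intpoint R m).
Proof.
move=> fxy; set z := ((x - Num.ceil p) %/ (lin_den f)%:Z)%Z.
exists (x - z * (lin_den f)%:Z, y - z * (lin_num f)%:Z).
apply/half_open_segment_intP; split.
  have := divz_eq (x - Num.ceil p) (lin_den f)%:Z; rewrite -/z.
  have := @modz_ge0 (x - Num.ceil p) (lin_den f)%:Z.
  have := @ltz_pmod (x - Num.ceil p) (lin_den f)%:Z.
  by set r := modz _ _; lia.
by rewrite !intrB !intrM -!pmulrn -mulNr linfracDM mulNr fxy.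
Qed.

Hypothesis co_num_den : coprime (lin_num f) (lin_den f).

(** From a (c - c') = b (d - d'), the coprimality of a and b gives b | c - c'. *)
Lemma linfrac_int_abscissas (c d c' d' : int) :
  f c%:~R = d%:~R -> f c'%:~R = d'%:~R ->
  ((lin_den f)%:Z %| c - c')%Z.
Proof.
move=> fc fc'; rewrite -(@Gauss_dvdzr _ (lin_num f)%:Z); last first.
  by rewrite coprimez_sym.
apply/dvdzP; exists (d - d').
apply: (@intr_inj R); rewrite !intrM !intrB -fc -fc' -!pmulrn /linfrac_eval.
by field; rewrite gt_eqF.
Qed.

(** Both abscissas lie in a window of b consecutive integers and agree modulo b. *)
Lemma segment_int_uniq (p : R) (m m' : int * int) :
  let on_segment (n : int * int) := half_open_segment (p, f p)
    ((lin_den f)%:R, (lin_num f)%:R) (intpoint R n) in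
  on_segment m -> on_segment m' -> m = m'.
Proof.
case: m m' => [c d] [c' d'] /= /half_open_segment_intP[c_in fc].
case/half_open_segment_intP=> c'_in fc'.
have /dvdzP[z cc'] := linfrac_int_abscissas _ _ _ _ fc fc'.
have c_eq : c = c' by move: cc'; case: (ltrgtP z 0); nia.
by rewrite c_eq in fc *; congr (_, _); apply: (@intr_inj R); rewrite -fc -fc'.
Qed.

Section Reciprocity.
Variables (A : comUnitRingType) (u v : A) (p : R).
Hypotheses (uu : u \is a GRing.unit) (vu : v \is a GRing.unit).

(** The segment carries no other integer point, so only the term of (c, d)
    survives in the correction sum. *)
Lemma reciprocity_int_point (c d : int) :
  half_open_segment (p, f p) ((lin_den f)%:R, (lin_num f)%:R) (intpoint R (c, d)) ->
  v * (1 - u) * rademacher_carlitz v u p f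
  + u * (1 - v) * rademacher_carlitz u v (f p) (linfrac_inv f)
  = u ^ Num.ceil p * v ^ Num.ceil (f p)
      * (1 - u ^+ lin_den f * v ^+ lin_num f)
    - u ^ c * v ^ d * (1 - u) * (1 - v).
Proof.
move=> seg_cd; rewrite rademacher_carlitz_reciprocity //; congr (_ - _).
have [/int_window_ordP[k c_eq] fc] := (half_open_segment_intP _ _ _).1 seg_cd.
rewrite big_mkord (bigD1 k) //= -c_eq fc intr_int intrKfloor.
rewrite big1 => [|j /eqP j_neq]; first by rewrite addr0 mulr1n mulrC !mulrA.
case: (boolP (_ \is a _)) => // /intrP[d' fj]; case: j_neq.
have seg_j : half_open_segment (p, f p) ((lin_den f)%:R, (lin_num f)%:R)
    (intpoint R (Num.ceil p + j%:Z, d')).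
  by apply/half_open_segment_intP; split=> //; apply/int_window_ordP; exists j.
have [] := segment_int_uniq _ _ _ seg_j seg_cd.
by rewrite c_eq => /addrI[j_eq] _; apply: val_inj.
Qed.

Lemma reciprocity_no_int_point :
  ~ (exists x y : int, y%:~R = f x%:~R) ->
  v * (1 - u) * rademacher_carlitz v u p f
  + u * (1 - v) * rademacher_carlitz u v (f p) (linfrac_inv f)
  = u ^ Num.ceil p * v ^ Num.ceil (f p)
      * (1 - u ^+ lin_den f * v ^+ lin_num f).
Proof.
move=> no_int; rewrite rademacher_carlitz_reciprocity // big1 ?mulr0 ?subr0 //.
move=> j _ /=; case: (boolP (_ \is a _)) => // /intrP[d fj].
by case: no_int; exists (Num.ceil p + j%:Z), d.
Qed.

End Reciprocity.

End LinFrac.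

Theorem theorem1 (R : realType) (K : comNzRingType)
    (a b : nat) (t p q : R) :
  (0 < a)%N -> (0 < b)%N -> coprime a b ->
  let f : linfrac R := LinFrac a t b in
  q = f p ->
  let u : laurent2 K := lvaru K in
  let v : laurent2 K := lvarv K in
  let lhs : laurent2 K :=
    v * (1 - u) * rademacher_carlitz v u p f
    + u * (1 - v) * rademacher_carlitz u v q (linfrac_inv f) in
  let main : laurent2 K :=
    u ^ Num.ceil p * v ^ Num.ceil q * (1 - u ^+ b * v ^+ a) in
  let on_segment (m : int * int) : Prop :=
    half_open_segment (p, q) (b%:R, a%:R) (intpoint R m) in
  let graph_has_int_point : Prop :=
    exists x y : int, y%:~R = f x%:~R in
  (graph_has_int_point ->
     (exists! m : int * int, on_segment m) /\
     forall c d : int, on_segment (c, d) ->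
       lhs = main - u ^ c * v ^ d * (1 - u) * (1 - v)) /\
  (~ graph_has_int_point ->
     (forall m : int * int, ~ on_segment m) /\
     lhs = main).
Proof.
move=> a_gt0 b_gt0 co_ab f -> u v lhs main on_segment graph_has_int_point.
have uu : u \is a GRing.unit by apply: lmonom_unit.
have vu : v \is a GRing.unit by apply: lmonom_unit.
split=> [[x [y fxy]] | no_int]; split.
- have [m m_seg] := segment_int_exists R f a_gt0 b_gt0 p x y (esym fxy).
  exists m; split=> // m'.
  exact: (segment_int_uniq R f a_gt0 b_gt0 co_ab p _ _ m_seg).
- by move=> c d; exact: (reciprocity_int_point R f a_gt0 b_gt0 co_ab _ u v p uu vu).
- move=> [c d] /(half_open_segment_intP R f b_gt0 p c d)[_ fc].
  by apply: no_int; exists c, d.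
- exact: (reciprocity_no_int_point R f a_gt0 b_gt0 _ u v p uu vu no_int).
Qed.
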